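(* Let $K\subset\mathbb{R}$ be a regular compact set, let $g$ be the Green function of $\overline{\mathbb{C}}\setminus K$ with pole at infinity, and for $\delta>0$ put $$G(\delta):=\max\{ g(z): z\in\mathbb{C},\ \operatorname{dist}(z,K)\le 2\delta\}.$$ Let $n\ge 1$ and let $x_0,\ldots,x_{n-1}\in K$ be (the first $n$ terms of) a Leja sequence. Then, for every $\delta>0$, the $n$-th Lebesgue constant satisfies $$\Lambda_n\le 2n\left[ \frac{\operatorname{diam}(K)}{\delta}\, e^{nG(\delta)}\right]^{9/8}.$$
   Context: A compact set $K\subset\mathbb{C}$ is regular if the Green function $g(z)=g_{\overline{\mathbb{C}}\setminus K}(z,\infty)$ of $\overline{\mathbb{C}}\setminus K$ with pole at infinity is continuous on $\mathbb{C}$ (with $g=0$ on $K$). A sequence $x_0,x_1,\ldots$ of points of $K$ is a Leja sequence if $x_0\in K$ is arbitrary and, for every $k\ge1$, $x_k$ is a point of global maximum on $K$ of $x\mapsto\prod_{j<k}|x-x_j|$. $C(K)$ is the space of continuous functions $f:K\to\mathbb{C}$ with the uniform norm. The Lagrange interpolation operator $T_n:C(K)\to C(K)$ is $T_nf(x)=\sum_{k=0}^{n-1}f(x_k)L_{k,n}(x)$, where $L_{k,n}(x)=\prod_{0\le j\le n-1,\,j\ne k}\frac{x-x_j}{x_k-x_j}$, and the $n$-th Lebesgue constant is the operator norm $\Lambda_n=\|T_n\|$. *)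

(* Defs.v *)
From Stdlib Require Import Reals.
From Coquelicot Require Import Coquelicot.
Open Scope R_scope.

Fixpoint prodR (f : nat -> R) (n : nat) : R :=
  match n with O => 1 | S m => prodR f m * f m end.

Fixpoint sumC (f : nat -> C) (n : nat) : C :=
  match n with O => RtoC 0 | S m => Cplus (sumC f m) (f m) end.

Definition onK (K : R -> Prop) (z : C) : Prop := exists x, K x /\ z = RtoC x.

Definition d2x (g : C -> R) (z : C) : R :=
  Derive (fun t => Derive (fun s => g (s, snd z)) t) (fst z).
Definition d2y (g : C -> R) (z : C) : R :=
  Derive (fun t => Derive (fun s => g (fst z, s)) t) (snd z).

Definition harmonic_at (g : C -> R) (z : C) : Prop :=
  exists eps : posreal, forall w : C, ball z eps w ->
    ex_derive (fun s => g (s, snd w)) (fst w) /\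
    ex_derive (fun s => g (fst w, s)) (snd w) /\
    ex_derive (fun t => Derive (fun s => g (s, snd w)) t) (fst w) /\
    ex_derive (fun t => Derive (fun s => g (fst w, s)) t) (snd w) /\
    continuous (d2x g) w /\ continuous (d2y g) w /\
    d2x g w + d2y g w = 0.

(* g is the Green function of (extended C) \ K with pole at infinity, and it is
   continuous on C (this is exactly regularity of K). *)
Definition green_function (K : R -> Prop) (g : C -> R) : Prop :=
  (forall z : C, continuous g z) /\
  (forall z : C, onK K z -> g z = 0) /\
  (forall z : C, ~ onK K z -> harmonic_at g z) /\
  (exists M R0 : R, forall z : C, R0 <= Cmod z -> Rabs (g z - ln (Cmod z)) <= M).

Definition is_leja (K : R -> Prop) (n : nat) (x : nat -> R) : Prop :=
  (forall k, (k < n)%nat -> K (x k)) /\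
  (forall k, (1 <= k < n)%nat -> forall y, K y ->
     prodR (fun j => Rabs (y - x j)) k <= prodR (fun j => Rabs (x k - x j)) k).

Definition lagrange_basis (x : nat -> R) (n k : nat) (t : R) : R :=
  prodR (fun j => if Nat.eqb j k then 1 else (t - x j) / (x k - x j)) n.

Definition interp (x : nat -> R) (n : nat) (f : R -> C) (t : R) : C :=
  sumC (fun k => Cmult (f (x k)) (RtoC (lagrange_basis x n k t))) n.

Definition continuous_on_K (K : R -> Prop) (f : R -> C) : Prop :=
  forall t, K t -> forall eps, 0 < eps -> exists d, 0 < d /\
    forall s, K s -> Rabs (s - t) < d -> Cmod (Cminus (f s) (f t)) < eps.

Definition lebesgue_constant (K : R -> Prop) (x : nat -> R) (n : nat) : Rbar :=
  Lub_Rbar (fun r => exists f : R -> C,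
     continuous_on_K K f /\ (forall t, K t -> Cmod (f t) <= 1) /\
     exists t, K t /\ r = Cmod (interp x n f t)).

Definition diam (K : R -> Prop) : R :=
  real (Lub_Rbar (fun r => exists a b, K a /\ K b /\ r = Rabs (a - b))).

Definition distK (K : R -> Prop) (z : C) : Rbar :=
  Glb_Rbar (fun r => exists w, K w /\ r = Cmod (Cminus z (RtoC w))).

Definition Gmax (K : R -> Prop) (g : C -> R) (delta : R) : R :=
  real (Lub_Rbar (fun r => exists z : C, Rbar_le (distK K z) (Finite (2 * delta)) /\ r = g z)).

(* Main.v *)
Require Import Defs.
From Stdlib Require Import Reals Psatz Classical ClassicalEpsilon.
From Coquelicot Require Import Coquelicot.
Open Scope R_scope.

(** Every Lagrange basis polynomial L_k is bounded on K by 2 (diam K / s)^(9/8), where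
    s = delta e^(-n G(delta)) is a lower bound for the distance between nodes.

    The separation comes from the Bernstein-Walsh inequality |P_j| <= ‖P_j‖_K e^(j g)
    for P_j = prod_(i<j) (X - x_i): at x_j, the modulus of P_j / (X - x_k) does not
    decrease when we move by delta in the imaginary direction, because all roots are
    real, so ‖P_j‖_K = |P_j(x_j)| <= |x_j - x_k| ‖P_j‖_K e^(nG) / delta.

    For the bound on L_k, put x_k at the origin and let q_j be the product of the
    factors of |L_k| with index below j. Initially q <= 1, adding the node y multiplies
    q(t) by |1 - t/y|, and the Leja property says that y maximizes |t| q(t).
    For -u < 0 < v in K, the mean of ln q(v) and ln q(-u) with weights u/(u+v) and
    v/(u+v) does not increase when a node outside (-u, v) is added, since
    ln (1 + z) <= z. When a node is added inside, the Leja property bounds the new mean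
    by the old one for the subinterval having this node as an endpoint, up to
    (9/8) ln (ratio of the lengths). As the intervals keep length >= s, the mean is at most
    (9/8) ln ((u+v)/s). Finally q(v) only exceeds earlier bounds when a node of sign
    opposite to v is added, and then the Leja property turns the bound on the mean into
    one on q(v), with an extra entropy term <= ln 2. *)

(** * Elementary inequalities for logarithms *)

(** Rational bounds for logarithms reduce [endpoint_replacement_cost] to this inequality. With w^2 =
    L t, the product (1-L)(1-t) is at most (1-w)^2 and the last factor on the left at most 3 w^2 -
    1, which leaves an inequality in w alone. *)
Lemma cost_polynomial_bound (L t : R) : 0<L<1 -> 0<t<1 -> 8*(1-L)*(1-t)*((1+L)*(1+t)/2-2+2*L*t) <= L*t*(1-L*t)*(1+t).
Proof.
intros HL Ht.
set (w := sqrt (L*t)).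
assert (HP : 0 < L*t) by nra.
assert (Hw : 0 < w) by (apply sqrt_lt_R0; exact HP).
assert (Hw2 : w*w = L*t) by (apply sqrt_sqrt; lra).
assert (Hw1 : w < 1) by nra.
assert (Hef : (1-L)*(1-t) <= (1-w)*(1-w)).
{ assert (2*w <= L+t); [|nra]. pose proof (Rle_0_sqr (L-t)); apply Rsqr_incr_0; unfold Rsqr in *; nra. }
assert (HB : (1+L)*(1+t)/2-2+2*L*t <= 3*(w*w)-1) by nra.
(* The difference of the two sides is smallest near w = 5/7, hence the choice of squares. *)
assert (Hu : 8*(1-w)*(3*(w*w)-1) <= w*w*(1+w)*(1+w*w)) by (clear -Hw Hw1; pose proof (Rle_0_sqr (w-5/7)) as A1; pose proof (Rle_0_sqr (w*w-25/49)) as A2; pose proof (Rmult_le_pos _ _ (Rlt_le _ _ Hw) A1) as A3; pose proof (Rmult_le_pos _ _ (Rlt_le _ _ Hw) A2) as A4; unfold Rsqr in *; nra).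
destruct (Rle_dec (3*(w*w)) 1) as [H|H].
- assert (0 <= L*t*(1-L*t)*(1+t)). { apply Rmult_le_pos; [apply Rmult_le_pos|]; nra. }
  assert (0 <= (1-L)*(1-t)) by nra. nra.
- assert (H1: (1-L)*(1-t)*((1+L)*(1+t)/2-2+2*L*t) <= (1-w)*(1-w)*(3*(w*w)-1)).
  { apply Rle_trans with ((1-L)*(1-t)*(3*(w*w)-1)).
    - apply Rmult_le_compat_l; nra.
    - apply Rmult_le_compat_r; nra. }
  assert (H2 : (1-w)*(8*(1-w)*(3*(w*w)-1)) <= (1-w)*(w*w*(1+w)*(1+w*w))) by (apply Rmult_le_compat_l; lra).
  assert (H3 : w*w*(1-w*w)*(1+w*w) <= w*w*(1-w*w)*(1+t)).
  { apply Rmult_le_compat_l; nra. }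
  rewrite <- Hw2. nra.
Qed.

Lemma ln_le_sub_1 (x : R) : 0 < x -> ln x <= x - 1.
Proof.
intros Hx.
pose proof (exp_ineq1_le (ln x)) as H.
rewrite exp_ln in H; lra.
Qed.

Lemma le_0_of_nondecreasing (f df : R -> R) (x : R) :
  0 < x < 1 -> (forall y, 0 < y -> is_derive f y (df y)) ->
  (forall y, 0 < y -> 0 <= df y) -> f 1 = 0 -> f x <= 0.
Proof.
intros Hx Hd Hp H1.
destruct (MVT_gen f x 1 df) as [c [Hc E]].
- intros y Hy. rewrite Rmin_left in Hy by lra. apply Hd; lra.
- intros y Hy. rewrite Rmin_left in Hy by lra.
  apply continuity_pt_filterlim, (ex_derive_continuous f).
  exists (df y); apply Hd; lra.
- rewrite Rmin_left in Hc by lra.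
  assert (0 <= df c) by (apply Hp; lra). nra.
Qed.

Lemma opp_ln_le (x : R) : 0 < x < 1 -> - ln x <= (1 - x) * (1 + x) / (2 * x).
Proof.
intros Hx.
assert (H : - ln x - (/ x - x) / 2 <= 0).
{ apply (le_0_of_nondecreasing (fun y => - ln y - (/ y - y) / 2)
    (fun y => (/ y - 1) ^ 2 / 2)).
  - exact Hx.
  - intros y Hy. auto_derive; [repeat split; lra | field; lra].
  - intros y Hy. pose proof (pow2_ge_0 (/ y - 1)). lra.
  - rewrite ln_1. field. }
replace ((1 - x) * (1 + x) / (2 * x)) with ((/ x - x) / 2) by (field; lra). lra.
Qed.

Lemma ln_le_pade (x : R) : 0 < x < 1 -> ln x <= - (2 * (1 - x) / (1 + x)).
Proof.
intros Hx.
assert (H : ln x + 2 * (1 - x) / (1 + x) <= 0).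
{ apply (le_0_of_nondecreasing (fun y => ln y + 2 * (1 - y) / (1 + y))
    (fun y => (1 - y) ^ 2 / (y * (1 + y) ^ 2))).
  - exact Hx.
  - intros y Hy. auto_derive; [repeat split; lra | field; lra].
  - intros y Hy. apply Rle_mult_inv_pos; [apply pow2_ge_0 |].
    apply Rmult_lt_0_compat; [lra | apply pow_lt; lra].
  - rewrite ln_1. field. }
lra.
Qed.

(* With L = x/(x+b), t = (x-a)/x and p = a/(a+b) one has 1 - p = (1-L)/(1-Lt) and
   L - p = Lt(1-p); elementary bounds on the logarithms bound the left-hand side by
   9Lt/8 <= - 9/8 ln (1-Lt), and this is the right-hand side. *)
Lemma endpoint_replacement_cost (x a b : R) : 0 < a < x -> 0 < b ->
  b / (x + b) * ln ((x - a) / x) + (x / (x + b) - a / (a + b)) * ln ((a + b) / b)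
    + a / (a + b) * ln ((a + b) / a) <= 9 / 8 * ln ((x + b) / (a + b)).
Proof.
intros Ha Hb.
set (L := x / (x + b)). set (t := (x - a) / x). set (p := a / (a + b)).
assert (HL : 0 < L < 1).
{ split; [apply Rdiv_lt_0_compat; lra |].
  apply Rlt_div_l; lra. }
assert (Ht : 0 < t < 1).
{ split; [apply Rdiv_lt_0_compat; lra |].
  apply Rlt_div_l; lra. }
assert (Hp : 0 < p < 1).
{ split; [apply Rdiv_lt_0_compat; lra |].
  apply Rlt_div_l; lra. }
assert (HLt : 0 < L * t < 1) by nra.
assert (E1 : b / (x + b) = 1 - L) by (unfold L; field; lra).
assert (E2 : (a + b) / b = / (1 - p)) by (unfold p; field; lra).
assert (E3 : (a + b) / a = / p) by (unfold p; field; lra).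
assert (E4 : (x + b) / (a + b) = / (1 - L * t)) by (unfold L, t; field; lra).
assert (E5 : L - p = L * t * (1 - p)) by (unfold L, t, p; field; lra).
assert (E6 : p = L * (1 - t) / (1 - L * t)).
{ unfold L, t, p; field; lra. }
rewrite E1, E2, E3, E4, !ln_Rinv by lra.
clearbody L t p. clear E1 E2 E3 E4 Ha Hb.
assert (F1 : p * - ln p <= L - p + p * - ln L).
{ assert (H : ln (L / p) <= L / p - 1)
    by (apply ln_le_sub_1, Rdiv_lt_0_compat; lra).
  unfold Rdiv in H. rewrite ln_mult, ln_Rinv in H by (try apply Rinv_0_lt_compat; lra).
  apply (Rmult_le_compat_l p) in H; [|lra].
  replace (p * (L * / p - 1)) with (L - p) in H by (field; lra). lra. }
assert (F2 : (1 - p) * - ln (1 - p) <= p).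
{ assert (H : ln (/ (1 - p)) <= / (1 - p) - 1)
    by (apply ln_le_sub_1, Rinv_0_lt_compat; lra).
  rewrite ln_Rinv in H by lra.
  apply (Rmult_le_compat_l (1 - p)) in H; [|lra].
  replace ((1 - p) * (/ (1 - p) - 1)) with p in H by (field; lra). exact H. }
assert (F3 : p * - ln L <= (1 - L) * (1 - t) * ((1 + L) / (2 * (1 - L * t)))).
{ apply Rle_trans with (p * ((1 - L) * (1 + L) / (2 * L))).
  - apply Rmult_le_compat_l; [lra | apply opp_ln_le, HL].
  - right. rewrite E6. field. lra. }
assert (F4 : (1 - L) * ln t <= (1 - L) * (- (2 * (1 - t) / (1 + t)))).
{ apply Rmult_le_compat_l; [lra | apply ln_le_pade, Ht]. }
(* By [F1] and [F7] the other terms add up to at most Lt(1-p) + Ltp = Lt, so this Lt/8 is the excess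
   of 9/8 over 1. *)
assert (F5 : (1 - L) * (1 - t) * ((1 + L) / (2 * (1 - L * t)))
    + (1 - L) * (- (2 * (1 - t) / (1 + t))) <= L * t / 8).
{ pose proof (cost_polynomial_bound L t HL Ht) as H.
  replace (_ + _) with
    (8 * (1 - L) * (1 - t) * ((1 + L) * (1 + t) / 2 - 2 + 2 * L * t)
       / (8 * ((1 - L * t) * (1 + t)))) by (field; lra).
  apply Rle_div_l; [nra |]. lra. }
assert (F6 : ln (1 - L * t) <= - (L * t)).
{ pose proof (ln_le_sub_1 (1 - L * t)). lra. }
assert (F7 : L * t * ((1 - p) * - ln (1 - p)) <= L * t * p)
  by (apply Rmult_le_compat_l; lra).
rewrite E5. lra.
Qed.

(* Gibbs' inequality for the weights b/(v+b) and v/(v+b) against 1/2, 1/2. *)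
Lemma binary_entropy_le (v b : R) : 0 < v -> 0 < b ->
  b * ln ((v + b) / b) + v * ln ((v + b) / v) <= (v + b) * ln 2.
Proof.
intros Hv Hb.
assert (G : forall c, 0 < c -> c * ln ((v + b) / c) <= (v + b) / 2 - c + c * ln 2).
{ intros c Hc.
  replace ((v + b) / c) with ((v + b) / (2 * c) * 2) by (field; lra).
  rewrite ln_mult by (try apply Rdiv_lt_0_compat; lra).
  assert (H : ln ((v + b) / (2 * c)) <= (v + b) / (2 * c) - 1)
    by (apply ln_le_sub_1, Rdiv_lt_0_compat; lra).
  apply (Rmult_le_compat_l c) in H; [|lra].
  replace (c * ((v + b) / (2 * c) - 1)) with ((v + b) / 2 - c) in H by (field; lra).
  lra. }
pose proof (G v Hv). pose proof (G b Hb). lra.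
Qed.

(** * Growth of the partial products in a Leja recursion *)

(** Here [fx], [fa], [fb] are the values of ln q at x, a, -b before the node a is added. The mean
    for (-b, x) has weights 1-L at x and L at -b, the mean for (-b, a) has 1-p at a and p at -b,
    where L = x/(x+b) and p = a/(a+b). The Leja property moves to a all the weight of x and the
    excess L-p of the weight of -b, at the cost bounded in [endpoint_replacement_cost]. *)
Lemma balanced_step (x a b fx fb fa E : R) : 0 < a < x -> 0 < b ->
  fx + ln x <= fa + ln a -> fb + ln b <= fa + ln a ->
  b * fa + a * fb <= (a + b) * E ->
  b * (fx + ln ((x - a) / a)) + x * (fb + ln ((a + b) / a))
    <= (x + b) * (E + 9 / 8 * ln ((x + b) / (a + b))).
Proof.
intros Ha Hb Hx Hfb HE.
pose proof (endpoint_replacement_cost x a b Ha Hb) as Hc.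
assert (A1 : fx + ln ((x - a) / a) <= fa + ln ((x - a) / x)).
{ rewrite !ln_div by lra. lra. }
assert (A2 : fb + ln ((a + b) / a) <= fa + ln ((a + b) / b)).
{ rewrite !ln_div by lra. lra. }
set (X := ln ((x - a) / x)) in *. set (Y := ln ((a + b) / b)) in *.
set (Z := ln ((a + b) / a)) in *. set (W := ln ((x + b) / (a + b))) in *.
set (V := ln ((x - a) / a)) in *. clearbody X Y Z W V.
set (L := x / (x + b)) in *. set (p := a / (a + b)) in *.
assert (EL : b / (x + b) = 1 - L) by (unfold L; field; lra).
assert (HL : 0 < L < 1).
{ split; [apply Rdiv_lt_0_compat; lra |]. apply Rlt_div_l; lra. }
assert (HpL : 0 <= L - p).
{ replace (L - p) with (b * (x - a) / ((x + b) * (a + b)))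
    by (unfold L, p; field; lra).
  apply Rle_mult_inv_pos; [nra |]. apply Rmult_lt_0_compat; lra. }
assert (HE' : (1 - p) * fa + p * fb <= E).
{ replace ((1 - p) * fa + p * fb) with ((b * fa + a * fb) / (a + b))
    by (unfold p; field; lra).
  apply Rle_div_l; lra. }
rewrite EL in Hc.
assert (Ex : x = (x + b) * L) by (unfold L; field; lra).
assert (Eb : b = (x + b) * (1 - L)) by (unfold L; field; lra).
assert (Hs : 0 < x + b) by lra.
replace (b * (fx + V) + x * (fb + Z)) with ((x + b) * ((1 - L) * (fx + V) + L * (fb + Z)))
  by (unfold L; field; lra).
apply Rmult_le_compat_l; [lra |].
apply (Rmult_le_compat_l (1 - L)) in A1; [|lra].
apply (Rmult_le_compat_l (L - p)) in A2; [|exact HpL].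
lra.
Qed.

(* [q j] stands for the modulus of the product of the first [k + 1 + j] factors of a
   Lagrange basis polynomial L_k, in the coordinate centred at [x k]. *)
Definition leja_recursion (K : R -> Prop) (y : nat -> R) (m : nat)
    (q : nat -> R -> R) (s : R) : Prop :=
  (forall j, (j < m)%nat -> K (y j) /\ s <= Rabs (y j)) /\
  (forall t, K t -> q O t <= 1) /\
  (forall j t, (j < m)%nat -> q (S j) t = q j t * Rabs (1 - t / y j)) /\
  (forall j t, (j < m)%nat -> K t ->
     Rabs t * q j t <= Rabs (y j) * q j (y j)).

Lemma leja_recursion_reflect K y m q s : leja_recursion K y m q s ->
  leja_recursion (fun t => K (- t)) (fun j => - y j) m (fun j t => q j (- t)) s.
Proof.
intros (H1 & H2 & H3 & H4). repeat split.
- rewrite Ropp_involutive. apply H1; assumption.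
- rewrite Rabs_Ropp. apply H1; assumption.
- intros t Ht. apply H2, Ht.
- intros j t Hj. rewrite H3 by exact Hj. f_equal. f_equal.
  unfold Rdiv. rewrite Rinv_opp. ring.
- intros j t Hj Ht. rewrite Ropp_involutive, Rabs_Ropp, <- (Rabs_Ropp t).
  apply H4; assumption.
Qed.

Lemma pos_of_mult_Rabs_pos (a b : R) : 0 < a * Rabs b -> 0 < a /\ b <> 0.
Proof.
intros H. pose proof (Rabs_pos b) as Hb.
assert (Hb' : b <> 0) by (intros ->; rewrite Rabs_R0, Rmult_0_r in H; lra).
split; [|exact Hb'].
pose proof (Rabs_pos_lt b Hb'). nra.
Qed.

Lemma ln_leja (a b p q : R) : 0 < a -> 0 < b -> 0 < p ->
  a * p <= b * q -> 0 < q /\ ln p + ln a <= ln q + ln b.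
Proof.
intros Ha Hb Hp H.
assert (Hq : 0 < q).
{ assert (0 < a * p) by (apply Rmult_lt_0_compat; assumption).
  destruct (Rle_or_lt q 0); [nra | assumption]. }
split; [exact Hq |].
rewrite <- !ln_mult by assumption.
apply ln_le; [apply Rmult_lt_0_compat; assumption | lra].
Qed.

Lemma Rabs_1_sub_div (t y : R) : y <> 0 -> Rabs (1 - t / y) = Rabs (y - t) / Rabs y.
Proof. intros Hy. rewrite <- Rabs_div by exact Hy. f_equal. field. exact Hy. Qed.

(** Both factors are positive, and after ln (1+z) <= z the linear terms -uv/y and uv/y cancel. *)
Lemma outside_node_le (u v y : R) : 0 < u -> 0 < v -> y < - u \/ v < y -> y <> 0 ->
  u * ln (Rabs (1 - v / y)) + v * ln (Rabs (1 - - u / y)) <= 0.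
Proof.
intros Hu Hv Hout Hy.
assert (P : 0 < 1 - v / y /\ 0 < 1 - - u / y).
{ destruct Hout as [H|H]; split.
  - replace (1 - v / y) with ((v - y) / - y) by (field; lra). apply Rdiv_lt_0_compat; lra.
  - replace (1 - - u / y) with ((- y - u) / - y) by (field; lra). apply Rdiv_lt_0_compat; lra.
  - replace (1 - v / y) with ((y - v) / y) by (field; lra). apply Rdiv_lt_0_compat; lra.
  - replace (1 - - u / y) with ((y + u) / y) by (field; lra). apply Rdiv_lt_0_compat; lra. }
destruct P as [Pv Pu].
rewrite !Rabs_pos_eq by lra.
pose proof (Rmult_le_compat_l u _ _ (Rlt_le _ _ Hu) (ln_le_sub_1 _ Pv)) as J1.
pose proof (Rmult_le_compat_l v _ _ (Rlt_le _ _ Hv) (ln_le_sub_1 _ Pu)) as J2.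
replace (v * (1 - - u / y - 1)) with (- (u * (1 - v / y - 1))) in J2 by (field; lra).
lra.
Qed.

(** The induction treats all pairs -u, v at once, because a node inside the interval leads to a
    subinterval ending there. Positivity of the values is assumed because [ln] is 0, not -oo, at
    0. *)
Lemma balanced_bound K y m q s : 0 < s -> leja_recursion K y m q s ->
  forall j, (j <= m)%nat -> forall u v, 0 < u -> 0 < v -> K (- u) -> K v ->
  0 < q j (- u) -> 0 < q j v -> s <= u + v ->
  u * ln (q j v) + v * ln (q j (- u)) <= (u + v) * (9 / 8 * ln ((u + v) / s)).
Proof.
intros Hs (Hy & H0 & HS & Hleja) j.
induction j as [|j IH]; intros Hj u v Hu Hv Ku Kv Pu Pv Hsuv.
- assert (ln (q O v) <= 0) by (rewrite <- ln_1; apply ln_le; [|apply H0]; assumption).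
  assert (ln (q O (- u)) <= 0) by (rewrite <- ln_1; apply ln_le; [|apply H0]; assumption).
  assert (0 <= ln ((u + v) / s)).
  { rewrite <- ln_1. apply ln_le; [lra |]. apply Rle_div_r; lra. }
  assert (0 <= (u + v) * (9 / 8 * ln ((u + v) / s))) by (apply Rmult_le_pos; lra).
  nra.
- assert (Hj' : (j < m)%nat) by (unfold lt; exact Hj).
  destruct (Hy j Hj') as [Ky sy].
  pose proof (Hleja j v Hj' Kv) as Lv. pose proof (Hleja j (- u) Hj' Ku) as Lu.
  rewrite HS in Pu, Pv |- * by exact Hj'. rewrite HS by exact Hj'.
  destruct (pos_of_mult_Rabs_pos _ _ Pu) as [Qu Nu].
  destruct (pos_of_mult_Rabs_pos _ _ Pv) as [Qv Nv].
  assert (IHj : forall u v, 0 < u -> 0 < v -> K (- u) -> K v ->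
    0 < q j (- u) -> 0 < q j v -> s <= u + v ->
    u * ln (q j v) + v * ln (q j (- u)) <= (u + v) * (9 / 8 * ln ((u + v) / s)))
    by (apply IH; apply Nat.lt_le_incl, Hj').
  clear IH.
  rewrite Rabs_Ropp, (Rabs_pos_eq u) in Lu by lra.
  rewrite (Rabs_pos_eq v) in Lv by lra.
  rewrite !ln_mult by (try apply Rabs_pos_lt; assumption).
  assert (Ny : y j <> 0) by (intros E; rewrite E, Rabs_R0 in sy; lra).
  assert (Nv' : y j <> v) by (intros E; apply Nv; rewrite E; field; lra).
  assert (Nu' : y j <> - u) by (intros E; apply Nu; rewrite E; field; lra).
  set (a := y j) in *.
  (* The costs of successive subintervals telescope. *)
  assert (Split : forall c, 0 < c -> 0 < u + v ->
    9 / 8 * ln (c / s) + 9 / 8 * ln ((u + v) / c) = 9 / 8 * ln ((u + v) / s)).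
  { intros c Hc Huv. rewrite !ln_div by lra. ring. }
  destruct (Rlt_or_le a (- u)) as [Ca|Ca]; [|destruct (Rlt_or_le v a) as [Cv|Cv]].
  + pose proof (outside_node_le u v a Hu Hv (or_introl Ca) Ny).
    specialize (IHj u v Hu Hv Ku Kv Qu Qv Hsuv). lra.
  + pose proof (outside_node_le u v a Hu Hv (or_intror Cv) Ny).
    specialize (IHj u v Hu Hv Ku Kv Qu Qv Hsuv). lra.
  + destruct (Rlt_or_le 0 a) as [Sa|Sa].
    * rewrite (Rabs_pos_eq a) in * by lra.
      destruct (ln_leja v a _ _ Hv Sa Qv Lv) as [Qa Lv'].
      destruct (ln_leja u a _ _ Hu Sa Qu Lu) as [_ Lu'].
      rewrite !Rabs_1_sub_div, (Rabs_pos_eq a) by lra.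
      rewrite (Rabs_left1 (a - v)), (Rabs_pos_eq (a - - u)) by lra.
      (* The subinterval is long enough since the node alone is at distance at least s from the
         origin. *)
      assert (Hua : s <= u + a) by lra.
      specialize (IHj u a Hu Sa Ku Ky Qu Qa Hua).
      rewrite (Rplus_comm u a) in IHj.
      assert (Hav : 0 < a < v) by lra.
      pose proof (balanced_step v a u _ _ _ _ Hav Hu Lv' Lu' IHj) as B.
      rewrite (Rplus_comm v u), Split in B by lra.
      replace (- (a - v)) with (v - a) by ring.
      replace (a - - u) with (a + u) by ring. exact B.
    (* Mirror image of the previous case, with u and v exchanged. *)
    * assert (Sa' : 0 < - a) by lra.
      rewrite (Rabs_left1 a) in * by lra.
      destruct (ln_leja v (- a) _ _ Hv Sa' Qv Lv) as [Qa Lv'].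
      destruct (ln_leja u (- a) _ _ Hu Sa' Qu Lu) as [_ Lu'].
      rewrite !Rabs_1_sub_div, (Rabs_left1 a) by lra.
      rewrite (Rabs_left1 (a - v)), (Rabs_pos_eq (a - - u)) by lra.
      assert (Hua : s <= - a + v) by lra.
      rewrite <- (Ropp_involutive a) in Ky at 1. rewrite <- (Ropp_involutive a) in Qa at 1.
      specialize (IHj (- a) v Sa' Hv Ky Kv Qa Qv Hua).
      rewrite Ropp_involutive, Rplus_comm in IHj.
      assert (Hav : 0 < - a < u) by lra.
      pose proof (balanced_step u (- a) v _ _ _ _ Hav Hv Lu' Lv' IHj) as B.
      rewrite Split in B by lra.
      replace (- (a - v)) with (- a + v) by ring.
      replace (a - - u) with (u - - a) by ring. lra.
Qed.

Lemma leja_recursion_ln_bound_pos K y m q s D : 0 < s <= D ->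
  leja_recursion K y m q s -> (forall u v, K u -> K v -> Rabs (u - v) <= D) ->
  forall j, (j <= m)%nat -> forall t, 0 < t -> K t -> 0 < q j t ->
  ln (q j t) <= ln 2 + 9 / 8 * ln (D / s).
Proof.
intros Hs Hrec HD j.
pose proof (balanced_bound K y m q s (proj1 Hs) Hrec) as Hbal.
destruct Hrec as (Hy & H0 & HS & Hleja).
induction j as [|j IH]; intros Hj t Ht Kt Pt.
- assert (ln (q O t) <= 0) by (rewrite <- ln_1; apply ln_le; [|apply H0]; assumption).
  assert (0 <= ln (D / s)) by (rewrite <- ln_1; apply ln_le; [lra | apply Rle_div_r; lra]).
  assert (0 < ln 2) by (rewrite <- ln_1; apply ln_increasing; lra).
  lra.
- assert (Hj' : (j < m)%nat) by (unfold lt; exact Hj).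
  destruct (Hy j Hj') as [Ky sy].
  pose proof (Hleja j t Hj' Kt) as Lt.
  rewrite HS in Pt |- * by exact Hj'.
  destruct (pos_of_mult_Rabs_pos _ _ Pt) as [Qt Nt].
  assert (IHj : forall t, 0 < t -> K t -> 0 < q j t ->
    ln (q j t) <= ln 2 + 9 / 8 * ln (D / s)) by (apply IH; apply Nat.lt_le_incl, Hj').
  clear IH.
  rewrite (Rabs_pos_eq t) in Lt by lra.
  rewrite ln_mult by (try apply Rabs_pos_lt; assumption).
  assert (Ny : y j <> 0) by (intros E; rewrite E, Rabs_R0 in sy; lra).
  assert (Nt' : y j <> t) by (intros E; apply Nt; rewrite E; field; lra).
  rewrite Rabs_1_sub_div by exact Ny.
  set (a := y j) in *.
  destruct (Rlt_or_le 0 a) as [Sa|Sa].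
  + rewrite (Rabs_pos_eq a) in * by lra.
    destruct (Rlt_or_le t a) as [Ca|Ca].
    * assert (ln (Rabs (a - t) / a) <= 0).
      { rewrite <- ln_1, Rabs_pos_eq by lra.
        apply ln_le; [apply Rdiv_lt_0_compat; lra | apply Rle_div_l; lra]. }
      specialize (IHj t Ht Kt Qt). lra.
    (* The new factor is at most t/a, so the Leja property bounds the new value at t by the old
       value at a. *)
    * destruct (ln_leja t a _ _ Ht Sa Qt Lt) as [Qa Lt'].
      specialize (IHj a Sa Ky Qa).
      rewrite Rabs_left1, ln_div by lra.
      assert (ln (- (a - t)) <= ln t) by (apply ln_le; lra). lra.
  (* The induction hypothesis is not called here: the bound restarts from the balanced one, so ln 2
     is paid only once. *)
  + set (b := - a). assert (Sb : 0 < b) by (unfold b; lra).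
    assert (Ea : a = - b) by (unfold b; ring). rewrite Ea in *.
    rewrite (Rabs_left1 (- b)), !Ropp_involutive in * by lra.
    destruct (ln_leja t b _ _ Ht Sb Qt Lt) as [Qb Lt'].
    specialize (Hbal j (Nat.lt_le_incl _ _ Hj') b t Sb Ht Ky Kt Qb Qt ltac:(lra)).
    assert (HbD : b + t <= D).
    { specialize (HD t (- b) Kt Ky). rewrite Rabs_pos_eq in HD by lra. lra. }
    assert (HE : ln ((b + t) / s) <= ln (D / s)).
    { apply ln_le; [apply Rdiv_lt_0_compat; lra |].
      apply Rmult_le_compat_r; [left; apply Rinv_0_lt_compat; lra | exact HbD]. }
    pose proof (binary_entropy_le t b Ht Sb) as Hent.
    replace (- b - t) with (- (t + b)) by ring.
    rewrite Rabs_Ropp, Rabs_pos_eq by lra.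
    rewrite !ln_div in Hent by lra. rewrite (ln_div (t + b)) by lra.
    assert (M1 : (b + t) * (9 / 8 * ln ((b + t) / s)) <= (b + t) * (9 / 8 * ln (D / s)))
      by (apply Rmult_le_compat_l; lra).
    assert (M2 : t * (ln (q j t) + ln t) <= t * (ln (q j (- b)) + ln b))
      by (apply Rmult_le_compat_l; lra).
    apply Rmult_le_reg_l with (t + b); lra.
Qed.

Lemma leja_recursion_ln_bound K y m q s D t : 0 < s <= D ->
  leja_recursion K y m q s -> (forall u v, K u -> K v -> Rabs (u - v) <= D) ->
  t <> 0 -> K t -> 0 < q m t -> ln (q m t) <= ln 2 + 9 / 8 * ln (D / s).
Proof.
intros Hs Hrec HD Ht Kt Pt.
destruct (Rtotal_order t 0) as [H|[H|H]]; [|contradiction|].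
- rewrite <- (Ropp_involutive t) in Kt, Pt |- *.
  apply leja_recursion_reflect in Hrec.
  refine (leja_recursion_ln_bound_pos _ _ _ _ s D Hs Hrec _ m (le_n m) (- t) _ Kt Pt).
  + intros u v Ku Kv. rewrite <- Rabs_Ropp.
    replace (- (u - v)) with (- u - - v) by ring. apply HD; assumption.
  + lra.
- exact (leja_recursion_ln_bound_pos _ _ _ _ s D Hs Hrec HD m (le_n m) t H Kt Pt).
Qed.

(** * Laplacians and the maximum principle *)

(** If A were positive, p, which vanishes at x, would be positive just to the right of x, and f
    would increase there. *)
Lemma second_derivative_at_max (f p : R -> R) (x A : R) :
  locally x (fun s => is_derive f s (p s)) -> is_derive p x A ->
  locally x (fun s => f s <= f x) -> A <= 0.
Proof.
intros [d1 H1] Hp [d2 H2].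
destruct (Rle_or_lt A 0) as [HA|HA]; [exact HA | exfalso].
assert (Df : forall s, Rabs (s - x) < d1 -> derivable_pt_lim f s (p s)).
{ intros s Hs. apply is_derive_Reals, H1, Hs. }
assert (Hd1 := cond_pos d1). assert (Hd2 := cond_pos d2).
assert (Dx : derivable_pt_lim f x (p x)) by (apply Df; rewrite Rminus_diag, Rabs_R0; lra).
assert (p0 : p x = 0).
{ pose (pr := exist _ (p x) Dx : derivable_pt f x).
  rewrite <- (derive_pt_eq_0 f x (p x) pr Dx).
  apply (deriv_maximum f (x - d2) (x + d2) x pr); [lra | lra |].
  intros s Hs1 Hs2. apply H2. change (Rabs (s - x) < d2). apply Rabs_def1; lra. }
apply is_derive_Reals in Hp. destruct (Hp A HA) as [d3 H3].
assert (Hd3 := cond_pos d3).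
set (h := Rmin d1 (Rmin d2 d3) / 2).
assert (Hh : 0 < h /\ h < d1 /\ h < d2 /\ h < d3).
{ unfold h. assert (0 < Rmin d1 (Rmin d2 d3)) by (repeat apply Rmin_pos; assumption).
  pose proof (Rmin_l d1 (Rmin d2 d3)). pose proof (Rmin_r d1 (Rmin d2 d3)).
  pose proof (Rmin_l d2 d3). pose proof (Rmin_r d2 d3). lra. }
destruct (MVT_cor2 f p x (x + h)) as [c [Ec Hc]].
- lra.
- intros c Hc. apply Df. rewrite Rabs_pos_eq; lra.
- assert (Hfh : f (x + h) <= f x).
  { apply H2. change (Rabs (x + h - x) < d2). rewrite Rabs_pos_eq; lra. }
  specialize (H3 (c - x) ltac:(lra)).
  rewrite Rabs_pos_eq in H3 by lra. specialize (H3 ltac:(lra)).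
  replace (x + (c - x)) with c in H3 by ring. rewrite p0 in H3.
  apply Rabs_def2 in H3.
  assert (0 < (p c - 0) / (c - x)) by lra.
  assert (p c = (p c - 0) / (c - x) * (c - x)) by (field; lra).
  assert (0 < p c) by (rewrite H0; apply Rmult_lt_0_compat; lra).
  assert (0 < p c * (x + h - x)) by (apply Rmult_lt_0_compat; lra). lra.
Qed.

(** The partial derivatives are explicit witnesses along the two axis lines through z, so that sums
    and multiples need no differentiability side conditions. *)
Definition has_laplacian (h : C -> R) (z : C) (l : R) : Prop :=
  exists (p q : R -> R) (A B : R),
    locally (fst z) (fun s => is_derive (fun r => h (r, snd z)) s (p s)) /\
    is_derive p (fst z) A /\
    locally (snd z) (fun s => is_derive (fun r => h (fst z, r)) s (q s)) /\
    is_derive q (snd z) B /\ l = A + B.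

Lemma laplacian_at_max h z l : has_laplacian h z l ->
  locally z (fun w => h w <= h z) -> l <= 0.
Proof.
destruct z as [x y]. intros (p & q & A & B & Hp & HA & Hq & HB & ->) [d Hd].
assert (A <= 0).
{ apply (second_derivative_at_max _ _ _ _ Hp HA). exists d. intros s Hs.
  apply (Hd (s, y)). split; [exact Hs | apply ball_center]. }
assert (B <= 0).
{ apply (second_derivative_at_max _ _ _ _ Hq HB). exists d. intros s Hs.
  apply (Hd (x, s)). split; [apply ball_center | exact Hs]. }
lra.
Qed.

Lemma has_laplacian_ext_loc h k z l : locally z (fun w => h w = k w) ->
  has_laplacian h z l -> has_laplacian k z l.
Proof.
intros [d Hd] (p & q & A & B & Hp & HA & Hq & HB & Hl).
exists p, q, A, B.
split; [|split; [exact HA |split; [|split; [exact HB | exact Hl]]]].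
- assert (L : locally (fst z) (fun s => locally s (fun r => h (r, snd z) = k (r, snd z)))).
  { apply locally_locally. exists d. intros s Hs. apply Hd.
    split; [exact Hs | apply ball_center]. }
  generalize (filter_and _ _ Hp L). apply filter_imp. intros s [D1 D2].
  apply (is_derive_ext_loc _ _ _ _ D2 D1).
- assert (L : locally (snd z) (fun s => locally s (fun r => h (fst z, r) = k (fst z, r)))).
  { apply locally_locally. exists d. intros s Hs. apply Hd.
    split; [apply ball_center | exact Hs]. }
  generalize (filter_and _ _ Hq L). apply filter_imp. intros s [D1 D2].
  apply (is_derive_ext_loc _ _ _ _ D2 D1).
Qed.

Lemma has_laplacian_plus h k z l m : has_laplacian h z l -> has_laplacian k z m ->
  has_laplacian (fun w => h w + k w) z (l + m).
Proof.
intros (p & q & A & B & Hp & HA & Hq & HB & ->) (p' & q' & A' & B' & Hp' & HA' & Hq' & HB' & ->).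
exists (fun s => p s + p' s), (fun s => q s + q' s), (A + A'), (B + B').
split; [|split; [|split; [|split]]].
- generalize (filter_and _ _ Hp Hp'). apply filter_imp. intros s [D1 D2].
  exact (is_derive_plus _ _ _ _ _ D1 D2).
- exact (is_derive_plus _ _ _ _ _ HA HA').
- generalize (filter_and _ _ Hq Hq'). apply filter_imp. intros s [D1 D2].
  exact (is_derive_plus _ _ _ _ _ D1 D2).
- exact (is_derive_plus _ _ _ _ _ HB HB').
- ring.
Qed.

Lemma has_laplacian_scal c h z l : has_laplacian h z l ->
  has_laplacian (fun w => c * h w) z (c * l).
Proof.
intros (p & q & A & B & Hp & HA & Hq & HB & ->).
exists (fun s => c * p s), (fun s => c * q s), (c * A), (c * B).
split; [|split; [|split; [|split]]].
- revert Hp. apply filter_imp. intros s D. exact (is_derive_scal _ _ _ _ D).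
- exact (is_derive_scal _ _ _ _ HA).
- revert Hq. apply filter_imp. intros s D. exact (is_derive_scal _ _ _ _ D).
- exact (is_derive_scal _ _ _ _ HB).
- ring.
Qed.

Lemma has_laplacian_harmonic g z : harmonic_at g z -> has_laplacian g z 0.
Proof.
intros [eps H].
exists (fun t => Derive (fun s => g (s, snd z)) t),
  (fun t => Derive (fun s => g (fst z, s)) t), (d2x g z), (d2y g z).
split; [|split; [|split; [|split]]].
- exists eps. intros s Hs. apply Derive_correct.
  apply (H (s, snd z)). split; [exact Hs | apply ball_center].
- apply Derive_correct. apply H, ball_center.
- exists eps. intros s Hs. apply Derive_correct.
  apply (H (fst z, s)). split; [apply ball_center | exact Hs].
- apply Derive_correct. apply H, ball_center.
- symmetry. apply H, ball_center.
Qed.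

Lemma locally_line_pos (f : R -> R) (x : R) : continuous f x -> 0 < f x ->
  locally x (fun s => 0 < f s).
Proof. intros Hc Hx. apply Hc. apply open_gt, Hx. Qed.

(** The case c = 0 gives harmonicity of ln |w - a|; the case c = 1 gives the strictly subharmonic
    damping term. *)
Lemma has_laplacian_ln_sqr_dist (a c : R) (z : C) : 0 < c + ((fst z - a) ^ 2 + snd z ^ 2) ->
  has_laplacian (fun w => ln (c + ((fst w - a) ^ 2 + snd w ^ 2))) z
    (4 * c / (c + ((fst z - a) ^ 2 + snd z ^ 2)) ^ 2).
Proof.
destruct z as [x y]. simpl fst. simpl snd. intros Hpos.
set (N := c + ((x - a) ^ 2 + y ^ 2)) in *.
exists (fun s => 2 * (s - a) / (c + ((s - a) ^ 2 + y ^ 2))),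
  (fun t => 2 * t / (c + ((x - a) ^ 2 + t ^ 2))),
  (2 / N - 4 * (x - a) ^ 2 / N ^ 2), (2 / N - 4 * y ^ 2 / N ^ 2).
split; [|split; [|split; [|split]]].
- assert (L : locally x (fun s => 0 < c + ((s - a) ^ 2 + y ^ 2))).
  { apply (locally_line_pos (fun s => c + ((s - a) ^ 2 + y ^ 2))); [|exact Hpos].
    apply (ex_derive_continuous (fun s => c + ((s - a) ^ 2 + y ^ 2))). auto_derive. exact I. }
  revert L. apply filter_imp. intros s Hs.
  cbn [fst snd]. auto_derive; [exact Hs | field; lra].
- cbn [fst snd]. unfold N in *. auto_derive; [lra | field; lra].
- assert (L : locally y (fun t => 0 < c + ((x - a) ^ 2 + t ^ 2))).
  { apply (locally_line_pos (fun t => c + ((x - a) ^ 2 + t ^ 2))); [|exact Hpos].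
    apply (ex_derive_continuous (fun t => c + ((x - a) ^ 2 + t ^ 2))). auto_derive. exact I. }
  revert L. apply filter_imp. intros s Hs.
  cbn [fst snd]. auto_derive; [exact Hs | field; lra].
- cbn [fst snd]. unfold N in *. auto_derive; [lra | field; lra].
- unfold N in *. field. lra.
Qed.

(** * Attained maxima in the plane *)

(** First maximize in y for each x; by uniform continuity the resulting maximum is continuous in
    x. *)
Lemma maximum_on_rectangle (f : R -> R -> R) (a b c d : R) : a <= b -> c <= d ->
  (forall x y, continuity_2d_pt f x y) ->
  exists x0 y0, forall x y, a <= x <= b -> c <= y <= d -> f x y <= f x0 y0.
Proof.
intros Hab Hcd Hf.
assert (Hm : forall x, exists y0, c <= y0 <= d /\ forall y, c <= y <= d -> f x y <= f x y0).
{ intros x. destruct (continuity_ab_maj (f x) c d Hcd) as [y0 [H1 H2]].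
  - intros y _ eps Heps.
    destruct (Hf x y (mkposreal eps Heps)) as [dl Hdl].
    exists dl. split; [apply cond_pos |]. intros u [_ Hu]. apply Hdl.
    + rewrite Rminus_diag, Rabs_R0. apply cond_pos.
    + exact Hu.
  - exists y0. split; assumption. }
set (Y x := proj1_sig (constructive_indefinite_description _ (Hm x))).
assert (HY : forall x, c <= Y x <= d /\ forall y, c <= y <= d -> f x y <= f x (Y x))
  by (intros x; exact (proj2_sig (constructive_indefinite_description _ (Hm x)))).
clearbody Y.
(* Clamping x to [a, b] keeps nearby points in the rectangle, where uniform continuity holds. *)
destruct (continuity_ab_maj (fun x => f (Rmax a (Rmin b x)) (Y (Rmax a (Rmin b x)))) a b Hab)
  as [x0 [H1 H2]].
- intros x _ eps Heps.
  destruct (uniform_continuity_2d f a b c d (fun x y _ _ => Hf x y) (mkposreal eps Heps))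
    as [dl Hdl].
  exists dl. split; [apply cond_pos |]. intros u [_ Hu].
  set (r := Rmax a (Rmin b x)). set (s := Rmax a (Rmin b u)).
  assert (Hr : a <= r <= b).
  { unfold r. split; [apply Rmax_l |]. apply Rmax_lub; [exact Hab | apply Rmin_l]. }
  assert (Hs : a <= s <= b).
  { unfold s. split; [apply Rmax_l |]. apply Rmax_lub; [exact Hab | apply Rmin_l]. }
  assert (Hrs : Rabs (s - r) < dl).
  { apply Rle_lt_trans with (2 := Hu). simpl. unfold R_dist, r, s, Rmax, Rmin.
    unfold Rabs.
    repeat destruct Rle_dec; repeat destruct Rcase_abs; lra. }
  assert (Hsr : Rabs (r - s) < dl) by (rewrite Rabs_minus_sym; exact Hrs).
  change (Rabs (f s (Y s) - f r (Y r)) < eps).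
  destruct (HY r) as [Yr1 Yr2]. destruct (HY s) as [Ys1 Ys2].
  assert (Z : forall y, Rabs (y - y) < dl)
    by (intros y; rewrite Rminus_diag, Rabs_R0; apply cond_pos).
  pose proof (Hdl r (Y s) s (Y s) Hr Ys1 Hs Ys1 Hrs (Z _)) as D1.
  pose proof (Hdl r (Y r) s (Y r) Hr Yr1 Hs Yr1 Hrs (Z _)) as D2.
  apply Rabs_def2 in D1. apply Rabs_def2 in D2. simpl in D1, D2.
  specialize (Yr2 (Y s) Ys1). specialize (Ys2 (Y r) Yr1).
  apply Rabs_def1; lra.
- exists (Rmax a (Rmin b x0)), (Y (Rmax a (Rmin b x0))). intros x y Hx Hy.
  apply Rle_trans with (f x (Y x)); [apply HY, Hy |].
  specialize (H1 x Hx). simpl in H1.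
  rewrite (Rmin_right b x), (Rmax_right a x) in H1 by lra. exact H1.
Qed.

(** The maximum over a square containing [z1] and the disc of radius r is global. *)
Lemma maximum_on_plane (F : C -> R) (z1 : C) (r : R) :
  (forall z, continuous F z) -> (forall z, r <= Cmod z -> F z <= F z1) ->
  exists z0, forall z, F z <= F z0.
Proof.
intros Hc Hr.
set (b := Rmax r (Cmod z1)).
assert (Hb : 0 <= b) by (apply Rle_trans with (2 := Rmax_r _ _), Cmod_ge_0).
destruct (maximum_on_rectangle (fun x y => F (x, y)) (- b) b (- b) b) as (x0 & y0 & H);
  try lra.
- intros x y. apply continuity_2d_pt_filterlim.
  apply filterlim_ext with F; [intros [u v]; reflexivity | exact (Hc (x, y))].
- assert (Hin : forall z, Cmod z <= b -> F z <= F (x0, y0)).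
  { intros [x y] Hz. pose proof (Rmax_Cmod (x, y)) as M. simpl in M.
    pose proof (Rmax_l (Rabs x) (Rabs y)). pose proof (Rmax_r (Rabs x) (Rabs y)).
    apply H; apply Rabs_le_between; lra. }
  exists (x0, y0). intros z. destruct (Rle_or_lt (Cmod z) b) as [Hz|Hz].
  + apply Hin, Hz.
  + apply Rle_trans with (F z1).
    * apply Hr. pose proof (Rmax_l r (Cmod z1)). unfold b in Hz. lra.
    * apply Hin, Rmax_r.
Qed.

(** * Finite products and the modulus of the node polynomial *)

Lemma prodR_ext (f h : nat -> R) (n : nat) :
  (forall i, (i < n)%nat -> f i = h i) -> prodR f n = prodR h n.
Proof.
induction n as [|n IH]; intros H; simpl; [reflexivity |].
rewrite IH, H by auto with arith. reflexivity.
Qed.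

Lemma prodR_mult (f h : nat -> R) (n : nat) :
  prodR (fun i => f i * h i) n = prodR f n * prodR h n.
Proof. induction n as [|n IH]; simpl; [ring | rewrite IH; ring]. Qed.

Lemma Rabs_prodR (f : nat -> R) (n : nat) :
  Rabs (prodR f n) = prodR (fun i => Rabs (f i)) n.
Proof. induction n as [|n IH]; simpl; [apply Rabs_R1 | rewrite Rabs_mult, IH; reflexivity]. Qed.

Lemma prodR_nonneg (f : nat -> R) (n : nat) :
  (forall i, (i < n)%nat -> 0 <= f i) -> 0 <= prodR f n.
Proof.
induction n as [|n IH]; intros H; simpl; [lra |].
apply Rmult_le_pos; [apply IH; auto with arith | apply H; auto with arith].
Qed.

Lemma prodR_pos (f : nat -> R) (n : nat) :
  (forall i, (i < n)%nat -> 0 < f i) -> 0 < prodR f n.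
Proof.
induction n as [|n IH]; intros H; simpl; [lra |].
apply Rmult_lt_0_compat; [apply IH; auto with arith | apply H; auto with arith].
Qed.

Lemma prodR_le (f h : nat -> R) (n : nat) :
  (forall i, (i < n)%nat -> 0 <= f i <= h i) -> prodR f n <= prodR h n.
Proof.
induction n as [|n IH]; intros H; simpl; [lra |].
apply Rmult_le_compat.
- apply prodR_nonneg. intros i Hi. apply H; auto with arith.
- apply H; auto with arith.
- apply IH; auto with arith.
- apply H; auto with arith.
Qed.

Lemma prodR_const (c : R) (n : nat) : prodR (fun _ => c) n = c ^ n.
Proof. induction n as [|n IH]; simpl; [reflexivity | rewrite IH; ring]. Qed.

Lemma prodR_neq_0 (f : nat -> R) (n i : nat) :
  prodR f n <> 0 -> (i < n)%nat -> f i <> 0.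
Proof.
induction n as [|n IH]; simpl; intros H Hi; [inversion Hi |].
destruct (Nat.eq_dec i n) as [->|Hne].
- intros E. apply H. rewrite E. ring.
- apply IH; [intros E; apply H; rewrite E; ring | lia].
Qed.

Definition node_modulus (a : nat -> R) (n : nat) (z : C) : R :=
  prodR (fun i => Cmod (Cminus z (RtoC (a i)))) n.

Lemma Cmod_sub_real (z : C) (a : R) :
  Cmod (Cminus z (RtoC a)) = sqrt ((fst z - a) ^ 2 + snd z ^ 2).
Proof.
destruct z as [x y]. unfold Cmod. simpl. f_equal. ring.
Qed.

Lemma Cmod_sub_real_on_axis (t a : R) :
  Cmod (Cminus (RtoC t) (RtoC a)) = Rabs (t - a).
Proof.
rewrite <- Cmod_R. f_equal. apply injective_projections; simpl; ring.
Qed.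

Lemma continuous_sqr_dist (c a : R) (z : C) :
  continuous (fun w : C => c + ((fst w - a) ^ 2 + snd w ^ 2)) z.
Proof.
assert (Hx : continuous (fun w : C => fst w - a) z).
{ apply (continuous_minus (fun w : C => fst w : R) (fun _ => a)).
  - apply continuous_fst.
  - apply continuous_const. }
assert (Hy : continuous (fun w : C => snd w) z) by apply continuous_snd.
apply (continuous_plus (fun _ : C => c) (fun w : C => (fst w - a) ^ 2 + snd w ^ 2)).
- apply continuous_const.
- apply (continuous_plus (fun w : C => (fst w - a) ^ 2) (fun w : C => snd w ^ 2)).
  + apply continuous_ext with (fun w : C => (fst w - a) * (fst w - a)).
    { intros w. apply Rsqr_pow2. }
    exact (continuous_mult _ _ _ Hx Hx).
  + apply continuous_ext with (fun w : C => snd w * snd w).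
    { intros w. apply Rsqr_pow2. }
    exact (continuous_mult _ _ _ Hy Hy).
Qed.

Lemma continuous_dist_node (a : R) (z : C) :
  continuous (fun w : C => Cmod (Cminus w (RtoC a))) z.
Proof.
apply continuous_ext with (fun w : C => sqrt (0 + ((fst w - a) ^ 2 + snd w ^ 2))).
{ intros w. rewrite Cmod_sub_real, Rplus_0_l. reflexivity. }
apply (continuous_comp (fun w : C => 0 + ((fst w - a) ^ 2 + snd w ^ 2)) sqrt).
- apply continuous_sqr_dist.
- apply continuous_sqrt.
Qed.

Lemma continuous_node_modulus a n z : continuous (node_modulus a n) z.
Proof.
unfold node_modulus. induction n as [|n IH]; simpl.
- apply continuous_const.
- exact (continuous_mult _ _ _ IH (continuous_dist_node (a n) z)).
Qed.

Lemma node_modulus_nonneg a n z : 0 <= node_modulus a n z.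
Proof. apply prodR_nonneg. intros i _. apply Cmod_ge_0. Qed.

Lemma locally_pos (f : C -> R) (z : C) : continuous f z -> 0 < f z ->
  locally z (fun w => 0 < f w).
Proof. intros Hc Hz. apply Hc. apply open_gt, Hz. Qed.

(** Near a point that is not a zero, the logarithm is a sum of terms ln |w - a_i|, each half the
    logarithm of a squared distance. *)
Lemma has_laplacian_ln_node_modulus a n z : 0 < node_modulus a n z ->
  has_laplacian (fun w => ln (node_modulus a n w)) z 0.
Proof.
induction n as [|n IH]; intros Hz.
- exists (fun _ => 0), (fun _ => 0), 0, 0.
  split; [|split; [|split; [|split]]].
  + apply filter_forall. intros s. apply (is_derive_const (ln 1)).
  + apply (is_derive_const (V := R_NormedModule) 0).
  + apply filter_forall. intros s. apply (is_derive_const (ln 1)).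
  + apply (is_derive_const (V := R_NormedModule) 0).
  + ring.
- change (0 < node_modulus a n z * Cmod (Cminus z (RtoC (a n)))) in Hz.
  pose proof (node_modulus_nonneg a n z) as P1.
  pose proof (Cmod_ge_0 (Cminus z (RtoC (a n)))) as P2.
  assert (Q1 : 0 < node_modulus a n z) by (destruct P1 as [P1|P1]; [exact P1 | rewrite <- P1 in Hz; lra]).
  assert (Q2 : 0 < Cmod (Cminus z (RtoC (a n)))) by (destruct P2 as [P2|P2]; [exact P2 | rewrite <- P2 in Hz; lra]).
  pose proof (locally_pos _ _ (continuous_node_modulus a n z) Q1) as L1.
  pose proof (locally_pos _ _ (continuous_dist_node (a n) z) Q2) as L2.
  assert (Q3 : 0 < 0 + ((fst z - a n) ^ 2 + snd z ^ 2)).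
  { rewrite Rplus_0_l. rewrite Cmod_sub_real in Q2. apply sqrt_lt_0_alt. rewrite sqrt_0. exact Q2. }
  pose proof (has_laplacian_plus _ _ _ _ _ (IH Q1)
    (has_laplacian_scal (/ 2) _ _ _ (has_laplacian_ln_sqr_dist (a n) 0 z Q3))) as H.
  replace 0 with (0 + / 2 * (4 * 0 / (0 + ((fst z - a n) ^ 2 + snd z ^ 2)) ^ 2)) at 1
    by (field; lra).
  revert H. apply has_laplacian_ext_loc.
  generalize (filter_and _ _ L1 L2). apply filter_imp. intros w [W1 W2].
  change (node_modulus a (S n) w) with (node_modulus a n w * Cmod (Cminus w (RtoC (a n)))).
  rewrite ln_mult by assumption. f_equal.
  rewrite Cmod_sub_real in W2 |- *. rewrite Rplus_0_l.
  rewrite <- (sqrt_sqrt ((fst w - a n) ^ 2 + snd w ^ 2)) at 1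
    by (apply Rplus_le_le_0_compat; apply pow2_ge_0).
  rewrite ln_mult by exact W2. field.
Qed.

(** * The Bernstein-Walsh inequality *)

Lemma exp_le_compat (x y : R) : x <= y -> exp x <= exp y.
Proof. intros [H | ->]; [left; apply exp_increasing, H | right; reflexivity]. Qed.

Lemma Rle_of_le_add_mult (A B c : R) :
  (forall eta, 0 < eta -> A <= B + eta * c) -> A <= B.
Proof.
intros H. apply le_epsilon. intros eps Heps.
assert (Hc : 0 < Rabs c + 1) by (pose proof (Rabs_pos c); lra).
specialize (H (eps / (Rabs c + 1)) ltac:(apply Rdiv_lt_0_compat; lra)).
assert (eps / (Rabs c + 1) * c <= eps).
{ apply Rle_trans with (eps / (Rabs c + 1) * (Rabs c + 1)).
  - apply Rmult_le_compat_l; [left; apply Rdiv_lt_0_compat; lra |].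
    pose proof (Rle_abs c). lra.
  - right. field. lra. }
lra.
Qed.

(* The damping [eta] makes the logarithm of the comparison function strictly
   subharmonic off [K] while it still tends to -oo at infinity, so that its maximum
   is attained on [K]. *)
Lemma bernstein_walsh (K : R -> Prop) (g : C -> R) (a : nat -> R) (n : nat) (M r : R) (z1 : C) :
  (forall t, K t -> Rabs t <= r) -> green_function K g ->
  (forall i, (i < n)%nat -> K (a i)) ->
  (forall t, K t -> prodR (fun i => Rabs (t - a i)) n <= M) ->
  0 < node_modulus a n z1 ->
  node_modulus a n z1 <= M * exp (INR n * g z1).
Proof.
intros Hr (gc & gK & gh & (Mg & R0 & gi)) Ha HM Hz1.
set (P := node_modulus a n) in *.
(* At infinity ln |P| grows like n ln |z|, g like ln |z| and the last logarithm like 2 ln |z|, so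
   the coefficient 3 leaves - eta ln |z|. *)
set (h := fun eta (z : C) => - (INR n + 3 * eta) * g z
  + eta * ln (1 + ((fst z - 0) ^ 2 + snd z ^ 2))).
assert (Key : forall eta, 0 < eta -> exists t, K t /\ 0 < P (RtoC t) /\
  P z1 * exp (h eta z1) <= P (RtoC t) * exp (h eta (RtoC t))).
{ intros eta Heta.
  set (F := fun z => P z * exp (h eta z)).
  assert (Fc : forall z, continuous F z).
  { intros z.
    refine (continuous_mult P (fun z => exp (h eta z)) z (continuous_node_modulus a n z) _).
    apply (continuous_comp (h eta) exp); [|apply continuous_exp].
    refine (continuous_plus (fun z => - (INR n + 3 * eta) * g z) (fun z => eta * _) z _ _).
    - exact (continuous_scal_r (- (INR n + 3 * eta)) g z (gc z)).
    - refine (continuous_scal_r eta (fun z : C => ln (1 + ((fst z - 0) ^ 2 + snd z ^ 2))) z _).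
      apply (continuous_comp (fun z : C => 1 + ((fst z - 0) ^ 2 + snd z ^ 2)) ln).
      + apply continuous_sqr_dist.
      + apply continuity_pt_filterlim, derivable_continuous_pt.
        exists (/ (1 + ((fst z - 0) ^ 2 + snd z ^ 2))).
        apply derivable_pt_lim_ln.
        pose proof (pow2_ge_0 (fst z - 0)). pose proof (pow2_ge_0 (snd z)). lra. }
  assert (F1 : 0 < F z1) by (apply Rmult_lt_0_compat; [exact Hz1 | apply exp_pos]).
  (* The constants of the growth estimates below, minus ln F(z1): once eta ln |z| exceeds this, F(z)
     <= F(z1). *)
  set (cst := INR n * ln 2 + (INR n + 3 * eta) * Mg + eta * ln 2 - ln (F z1)).
  set (rho := Rmax (Rmax R0 1) (Rmax r (exp (cst / eta)))).
  destruct (maximum_on_plane F z1 rho Fc) as [z0 Hmax].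
  { intros z Hz.
    assert (B1 : R0 <= Cmod z).
    { apply Rle_trans with (2 := Hz). apply Rle_trans with (2 := Rmax_l _ _). apply Rmax_l. }
    assert (B2 : 1 <= Cmod z).
    { apply Rle_trans with (2 := Hz). apply Rle_trans with (2 := Rmax_l _ _). apply Rmax_r. }
    assert (B3 : r <= Cmod z).
    { apply Rle_trans with (2 := Hz). apply Rle_trans with (2 := Rmax_r _ _). apply Rmax_l. }
    assert (B4 : cst / eta <= ln (Cmod z)).
    { rewrite <- (ln_exp (cst / eta)). apply ln_le; [apply exp_pos |].
      apply Rle_trans with (2 := Hz). apply Rle_trans with (2 := Rmax_r _ _). apply Rmax_r. }
    destruct (node_modulus_nonneg a n z) as [PP|PP].
    2:{ unfold F. unfold P at 1. rewrite <- PP, Rmult_0_l. left. exact F1. }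
    change (0 < P z) in PP.
    assert (C1 : ln (P z) <= INR n * (ln 2 + ln (Cmod z))).
    { rewrite <- ln_mult by lra. rewrite <- ln_pow by lra.
      apply ln_le; [exact PP |]. rewrite <- prodR_const.
      apply prodR_le. intros i Hi. split; [apply Cmod_ge_0 |].
      apply Rle_trans with (1 := Cmod_triangle _ _).
      rewrite Cmod_opp, Cmod_R. pose proof (Hr _ (Ha i Hi)). lra. }
    assert (C2 : Mg >= ln (Cmod z) - g z).
    { specialize (gi z B1). apply Rabs_le_between in gi. lra. }
    assert (C3 : ln (1 + ((fst z - 0) ^ 2 + snd z ^ 2)) <= ln 2 + 2 * ln (Cmod z)).
    { replace (ln 2 + 2 * ln (Cmod z)) with (ln (2 * (Cmod z * Cmod z)))
        by (rewrite !ln_mult by nra; ring).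
      apply ln_le.
      - pose proof (pow2_ge_0 (fst z - 0)). pose proof (pow2_ge_0 (snd z)). lra.
      - assert (E : Cmod z * Cmod z = (fst z - 0) ^ 2 + snd z ^ 2).
        { rewrite Rminus_0_r. unfold Cmod. apply sqrt_sqrt.
          apply Rplus_le_le_0_compat; apply pow2_ge_0. }
        rewrite <- E. nra. }
    assert (C4 : cst <= eta * ln (Cmod z)).
    { apply Rle_div_l in B4; lra. }
    assert (C5 : (INR n + 3 * eta) * (ln (Cmod z) - g z) <= (INR n + 3 * eta) * Mg).
    { apply Rmult_le_compat_l; [pose proof (pos_INR n); lra | lra]. }
    assert (C6 : eta * ln (1 + ((fst z - 0) ^ 2 + snd z ^ 2)) <= eta * (ln 2 + 2 * ln (Cmod z)))
      by (apply Rmult_le_compat_l; lra).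
    assert (Fz : 0 < F z) by (apply Rmult_lt_0_compat; [exact PP | apply exp_pos]).
    rewrite <- (exp_ln (F z)), <- (exp_ln (F z1)) by assumption. apply exp_le_compat.
    unfold F at 1. rewrite ln_mult, ln_exp by (try apply exp_pos; exact PP).
    unfold h. unfold cst in C4. lra. }
  assert (F0 : 0 < F z0) by (apply Rlt_le_trans with (1 := F1), Hmax).
  assert (P0 : 0 < P z0).
  { destruct (node_modulus_nonneg a n z0) as [PP|PP]; [exact PP |].
    unfold F in F0. unfold P at 1 in F0. rewrite <- PP in F0. lra. }
  (* A maximum point on K is what is sought; off K the Laplacian of ln F would be positive at a
     maximum. *)
  destruct (classic (onK K z0)) as [[t [Kt ->]]|HnK].
  { exists t. split; [exact Kt |]. split; [exact P0 | apply Hmax]. }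
  exfalso.
  assert (N0 : 0 < 1 + ((fst z0 - 0) ^ 2 + snd z0 ^ 2)).
  { pose proof (pow2_ge_0 (fst z0 - 0)). pose proof (pow2_ge_0 (snd z0)). lra. }
  pose proof (has_laplacian_plus _ _ _ _ _
    (has_laplacian_ln_node_modulus a n z0 P0)
    (has_laplacian_plus _ _ _ _ _
      (has_laplacian_scal (- (INR n + 3 * eta)) _ _ _ (has_laplacian_harmonic g z0 (gh z0 HnK)))
      (has_laplacian_scal eta _ _ _ (has_laplacian_ln_sqr_dist 0 1 z0 N0)))) as HL.
  assert (Hle := laplacian_at_max _ _ _ HL).
  assert (0 < 4 * 1 / (1 + ((fst z0 - 0) ^ 2 + snd z0 ^ 2)) ^ 2).
  { apply Rdiv_lt_0_compat; [lra | apply pow_lt, N0]. }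
  assert (0 < eta * (4 * 1 / (1 + ((fst z0 - 0) ^ 2 + snd z0 ^ 2)) ^ 2))
    by (apply Rmult_lt_0_compat; lra).
  enough (0 + (- (INR n + 3 * eta) * 0 + eta * (4 * 1 / (1 + ((fst z0 - 0) ^ 2 + snd z0 ^ 2)) ^ 2)) <= 0) by lra.
  apply Hle.
  generalize (locally_pos _ _ (continuous_node_modulus a n z0) P0).
  apply filter_imp. intros w Pw.
  change (ln (P w) + h eta w <= ln (P z0) + h eta z0).
  rewrite <- (ln_exp (h eta w)), <- (ln_exp (h eta z0)).
  rewrite <- !ln_mult by (try apply exp_pos; assumption).
  apply ln_le; [apply Rmult_lt_0_compat; [exact Pw | apply exp_pos] | apply Hmax]. }
assert (PK : forall t, K t -> P (RtoC t) <= M).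
{ intros t Kt. apply Rle_trans with (2 := HM t Kt). right. apply prodR_ext.
  intros i _. apply Cmod_sub_real_on_axis. }
assert (M0 : 0 < M).
{ destruct (Key 1 Rlt_0_1) as (t & Kt & Pt & _). specialize (PK t Kt). lra. }
rewrite <- (exp_ln (P z1)) by exact Hz1. rewrite <- (exp_ln M) by exact M0.
rewrite <- exp_plus. apply exp_le_compat.
(* Now eta tends to 0; the constant collects the damping terms at z1 and on K. *)
apply Rle_of_le_add_mult with (3 * g z1 + ln (1 + r ^ 2)).
intros eta Heta.
destruct (Key eta Heta) as (t & Kt & Pt & Ht).
apply ln_le in Ht; [|apply Rmult_lt_0_compat; [exact Hz1 | apply exp_pos]].
rewrite !ln_mult, !ln_exp in Ht by (try apply exp_pos; assumption).
unfold h in Ht. rewrite (gK (RtoC t)) in Ht by (exists t; split; [exact Kt | reflexivity]).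
assert (D1 : ln (P (RtoC t)) <= ln M) by (apply ln_le; [exact Pt | apply PK, Kt]).
assert (D2 : 0 <= ln (1 + ((fst z1 - 0) ^ 2 + snd z1 ^ 2))).
{ apply Rle_trans with (ln 1); [rewrite ln_1; lra |]. apply ln_le; [lra |].
  pose proof (pow2_ge_0 (fst z1 - 0)). pose proof (pow2_ge_0 (snd z1)). lra. }
assert (D3 : ln (1 + ((fst (RtoC t) - 0) ^ 2 + snd (RtoC t) ^ 2)) <= ln (1 + r ^ 2)).
{ cbn [fst snd RtoC]. apply ln_le; [pose proof (pow2_ge_0 (t - 0)); pose proof (pow2_ge_0 0); lra |].
  pose proof (Hr t Kt) as Hrt. pose proof (Rabs_pos t).
  assert (t ^ 2 <= r ^ 2) by (rewrite <- (pow2_abs t); apply pow_incr; lra).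
  replace (1 + ((t - 0) ^ 2 + 0 ^ 2)) with (1 + t ^ 2) by ring. lra. }
assert (0 <= eta * ln (1 + ((fst z1 - 0) ^ 2 + snd z1 ^ 2))) by (apply Rmult_le_pos; lra).
apply (Rmult_le_compat_l eta) in D3; [|lra]. lra.
Qed.

(** * Diameter, distance to K and G(delta) *)

(** Since [real] sends infinite values to 0, an upper bound B is required to make the supremum
    finite. *)
Lemma Rbar_le_real_Lub (E : R -> Prop) (v B : R) : E v -> (forall w, E w -> w <= B) ->
  v <= real (Lub_Rbar E).
Proof.
intros Ev HB.
destruct (Lub_Rbar_correct E) as [H1 H2].
specialize (H1 v Ev). specialize (H2 (Finite B) HB).
destruct (Lub_Rbar E); simpl in *; [exact H1 | contradiction | contradiction].
Qed.

Lemma le_diam K r u v : (forall t, K t -> Rabs t <= r) -> K u -> K v ->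
  Rabs (u - v) <= diam K.
Proof.
intros Hr Ku Kv. apply Rbar_le_real_Lub with (r + r).
- exists u, v. repeat split; assumption.
- intros w (a & b & Ka & Kb & ->).
  apply Rle_trans with (1 := Rabs_triang _ _). rewrite Rabs_Ropp.
  apply Rplus_le_compat; apply Hr; assumption.
Qed.

(** The distance is an infimum, so a point of K is extracted with the slack d < d'. *)
Lemma distK_le_ex K z d d' : Rbar_le (distK K z) (Finite d) -> d < d' ->
  exists w, K w /\ Cmod (Cminus z (RtoC w)) < d'.
Proof.
intros Hd Hdd. apply NNPP. intros Hno.
assert (H : Rbar_le (Finite d') (distK K z)).
{ apply Glb_Rbar_correct. intros u (w & Kw & ->). simpl.
  destruct (Rle_or_lt d' (Cmod (Cminus z (RtoC w)))) as [H|H]; [exact H |].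
  exfalso. apply Hno. exists w. split; assumption. }
pose proof (Rbar_le_trans _ _ _ H Hd) as H'. simpl in H'. lra.
Qed.

Lemma distK_vertical_le K t y : K t -> 0 <= y -> Rbar_le (distK K (t, y)) (Finite y).
Proof.
intros Kt Hy. apply Glb_Rbar_correct. exists t. split; [exact Kt |].
rewrite Cmod_sub_real. simpl fst. simpl snd.
replace ((t - t) ^ 2 + y ^ 2) with (y ^ 2) by ring. rewrite sqrt_pow2 by exact Hy.
reflexivity.
Qed.

Lemma le_Gmax K g delta r z : (forall t, K t -> Rabs t <= r) ->
  (forall z : C, continuous g z) -> 0 < delta -> 0 <= r ->
  Rbar_le (distK K z) (Finite (2 * delta)) -> g z <= Gmax K g delta.
Proof.
intros Hr Hg Hd Hr0 Hz.
(* Radius 3 delta in place of 2 delta provides the slack for [distK_le_ex]. *)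
set (b := r + 3 * delta).
destruct (maximum_on_rectangle (fun x y => g (x, y)) (- b) b (- b) b)
  as (x0 & y0 & H); try (unfold b; lra).
{ intros x y. apply continuity_2d_pt_filterlim.
  apply filterlim_ext with g; [intros [u v]; reflexivity | exact (Hg (x, y))]. }
apply Rbar_le_real_Lub with (g (x0, y0)).
- exists z. split; [exact Hz | reflexivity].
- intros u ([x y] & Hxy & ->).
  destruct (distK_le_ex _ _ _ (3 * delta) Hxy) as (w & Kw & Hw); [lra |].
  assert (Hm : Cmod (x, y) <= b).
  { replace (x, y) with (Cplus (Cminus (x, y) (RtoC w)) (RtoC w))
      by (apply injective_projections; simpl; ring).
    apply Rle_trans with (1 := Cmod_triangle _ _). rewrite Cmod_R.
    specialize (Hr w Kw). unfold b. lra. }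
  pose proof (Rmax_Cmod (x, y)) as M. simpl in M.
  pose proof (Rmax_l (Rabs x) (Rabs y)). pose proof (Rmax_r (Rabs x) (Rabs y)).
  apply H; apply Rabs_le_between; lra.
Qed.

Lemma Gmax_nonneg K g delta r t : (forall t, K t -> Rabs t <= r) ->
  green_function K g -> 0 < delta -> K t -> 0 <= Gmax K g delta.
Proof.
intros Hr (gc & gK & _) Hd Kt.
rewrite <- (gK (RtoC t)) by (exists t; split; [exact Kt | reflexivity]).
apply le_Gmax with r; try assumption.
- apply Rle_trans with (2 := Hr t Kt). apply Rabs_pos.
- apply Rbar_le_trans with (Finite 0); [apply distK_vertical_le; [exact Kt | lra] |].
  simpl. lra.
Qed.

(** * Separation of the nodes *)

(** Free of division, hence valid when f k = 0. It serves with c = delta for the separation and with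
    c = 1 to delete the factor of x_k. *)
Lemma prodR_update (f : nat -> R) (c : R) (k n : nat) : (k < n)%nat ->
  prodR (fun i => if Nat.eqb i k then c else f i) n * f k = c * prodR f n.
Proof.
induction n as [|n IH]; intros Hk; [inversion Hk |]. simpl.
destruct (Nat.eqb_spec n k) as [->|Hne].
- rewrite (prodR_ext (fun i => if Nat.eqb i k then c else f i) f k).
  + ring.
  + intros i Hi. destruct (Nat.eqb_spec i k); [lia | reflexivity].
- transitivity (prodR (fun i => if Nat.eqb i k then c else f i) n * f k * f n); [ring |].
  rewrite IH by lia. ring.
Qed.

Lemma node_modulus_vertical_pos a n t y : 0 < y -> 0 < node_modulus a n (t, y).
Proof.
intros Hy. apply prodR_pos. intros i _. rewrite Cmod_sub_real. apply sqrt_lt_R0.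
simpl fst. simpl snd. pose proof (pow2_ge_0 (t - a i)). pose proof (pow_lt y 2 Hy). lra.
Qed.

(** As G(delta) >= 0, the degree may be replaced by any larger N, which gives one exponent for all
    partial products. *)
Lemma bernstein_walsh_vertical K g a n M r delta t N :
  (forall t, K t -> Rabs t <= r) -> green_function K g -> 0 < delta -> K t ->
  (forall i, (i < n)%nat -> K (a i)) ->
  (forall t, K t -> prodR (fun i => Rabs (t - a i)) n <= M) -> (n <= N)%nat ->
  node_modulus a n (t, delta) <= M * exp (INR N * Gmax K g delta).
Proof.
intros Hr Hg Hd Kt Ha HM HN.
apply Rle_trans with (M * exp (INR n * g (t, delta))).
- apply bernstein_walsh with K r; try assumption. apply node_modulus_vertical_pos, Hd.
- apply Rmult_le_compat_l.
  + apply Rle_trans with (2 := HM t Kt). apply prodR_nonneg. intros i _. apply Rabs_pos.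
  + apply exp_le_compat.
    apply Rle_trans with (INR n * Gmax K g delta).
    * apply Rmult_le_compat_l; [apply pos_INR |].
      apply le_Gmax with r; try assumption; [apply Hg | |].
      -- apply Rle_trans with (2 := Hr t Kt). apply Rabs_pos.
      -- apply Rbar_le_trans with (Finite delta); [apply distK_vertical_le; [exact Kt | lra] |].
         simpl. lra.
    * apply Rmult_le_compat_r; [apply Gmax_nonneg with r t; assumption | apply le_INR, HN].
Qed.

(* Since the nodes are real, moving vertically by [delta] from [x j] increases the
   distance to every node, and makes the distance to [x k] at least [delta]. *)
Lemma leja_separation K g n x r delta k j :
  (forall t, K t -> Rabs t <= r) -> green_function K g -> 0 < delta -> is_leja K n x ->
  (k < j < n)%nat -> 0 < prodR (fun i => Rabs (x j - x i)) j ->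
  delta / exp (INR n * Gmax K g delta) <= Rabs (x j - x k).
Proof.
intros Hr Hg Hd [HxK Hx] Hkj HM.
set (M := prodR (fun i => Rabs (x j - x i)) j) in *.
assert (Kj : K (x j)) by (apply HxK; lia).
assert (U : node_modulus x j (x j, delta) <= M * exp (INR n * Gmax K g delta)).
{ apply bernstein_walsh_vertical with r; try assumption; [| | lia].
  - intros i Hi. apply HxK. lia.
  - intros t Kt. apply Hx; [lia | exact Kt]. }
assert (V : prodR (fun i => if Nat.eqb i k then delta else Rabs (x j - x i)) j
  <= node_modulus x j (x j, delta)).
{ apply prodR_le. intros i Hi. rewrite Cmod_sub_real. simpl fst. simpl snd.
  destruct (Nat.eqb i k); split; try apply Rabs_pos; try lra.
  - rewrite <- (sqrt_pow2 delta) at 1 by lra. apply sqrt_le_1_alt.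
    pose proof (pow2_ge_0 (x j - x i)). lra.
  - rewrite <- sqrt_Rsqr_abs. apply sqrt_le_1_alt. rewrite Rsqr_pow2.
    pose proof (pow2_ge_0 delta). lra. }
assert (W := prodR_update (fun i => Rabs (x j - x i)) delta k j (proj1 Hkj)).
simpl in W. fold M in W.
assert (He := exp_pos (INR n * Gmax K g delta)).
apply Rle_div_l; [exact He |].
apply Rmult_le_reg_l with M; [exact HM |].
rewrite (Rmult_comm M delta), <- W.
apply Rle_trans with (M * exp (INR n * Gmax K g delta) * Rabs (x j - x k)); [|right; ring].
apply Rmult_le_compat_r; [apply Rabs_pos | lra].
Qed.

(** Bernstein-Walsh for the linear polynomial X - t, at the point t + i delta. It says that the
    separation s is at most diam K. *)
Lemma delta_le_diam_mul_exp K g n r delta t :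
  (forall t, K t -> Rabs t <= r) -> green_function K g -> 0 < delta -> K t -> (1 <= n)%nat ->
  delta <= diam K * exp (INR n * Gmax K g delta).
Proof.
intros Hr Hg Hd Kt Hn.
replace delta with (node_modulus (fun _ => t) 1 (t, delta)) at 1.
- apply bernstein_walsh_vertical with r; try assumption.
  + intros i _. exact Kt.
  + intros u Ku. simpl. rewrite Rmult_1_l. apply le_diam with r; assumption.
- unfold node_modulus. simpl prodR. rewrite Cmod_sub_real. simpl fst. simpl snd.
  replace ((t - t) ^ 2 + delta ^ 2) with (delta ^ 2) by ring.
  rewrite sqrt_pow2 by lra. ring.
Qed.

(** * Bounds for the Lagrange basis *)

Lemma Rabs_lagrange_basis_mul x n k t :
  (forall i, (i < n)%nat -> i <> k -> x k <> x i) ->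
  Rabs (lagrange_basis x n k t) *
    prodR (fun i => if Nat.eqb i k then 1 else Rabs (x k - x i)) n =
  prodR (fun i => if Nat.eqb i k then 1 else Rabs (t - x i)) n.
Proof.
intros Hx. unfold lagrange_basis. rewrite Rabs_prodR, <- prodR_mult. apply prodR_ext.
intros i Hi. destruct (Nat.eqb_spec i k) as [E|E].
- rewrite Rabs_R1. ring.
- specialize (Hx i Hi E). rewrite Rabs_div by lra. field. apply Rabs_no_R0. lra.
Qed.

Lemma lagrange_basis_node x n k :
  (forall i, (i < n)%nat -> i <> k -> x k <> x i) -> lagrange_basis x n k (x k) = 1.
Proof.
intros Hx. unfold lagrange_basis. transitivity (prodR (fun _ => 1) n).
- apply prodR_ext. intros i Hi. destruct (Nat.eqb_spec i k) as [E|E]; [reflexivity |].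
  specialize (Hx i Hi E). field. lra.
- rewrite prodR_const. apply pow1.
Qed.

(** Division by 0 gives 0, so a node repeating x_k also makes the basis function vanish. *)
Lemma lagrange_basis_neq_0 x n k t i : lagrange_basis x n k t <> 0 ->
  (i < n)%nat -> i <> k -> t <> x i /\ x k <> x i.
Proof.
intros HL Hi Hik.
pose proof (prodR_neq_0 _ _ i HL Hi) as H. simpl in H.
destruct (Nat.eqb_spec i k) as [E|_]; [contradiction |].
split; intros E; apply H; rewrite E; unfold Rdiv; rewrite Rminus_diag;
  [ring | rewrite Rinv_0; ring].
Qed.

(** Multiplication by the positive denominator of L_k turns both inequalities into Leja maximality:
    that of x_k for q_0 <= 1, that of the later nodes for the last condition. *)
Lemma leja_recursion_lagrange K n x k s :
  is_leja K n x -> (k < n)%nat ->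
  (forall j, (k < j < n)%nat -> s <= Rabs (x j - x k)) ->
  (forall i, (i < n)%nat -> i <> k -> x k <> x i) ->
  leja_recursion (fun u => K (u + x k)) (fun i => x (k + 1 + i)%nat - x k) (n - k - 1)
    (fun i u => Rabs (lagrange_basis x (k + 1 + i) k (u + x k))) s.
Proof.
intros [HxK Hx] Hk Hs Hd.
assert (W : forall j, (j <= n)%nat ->
  0 < prodR (fun i => if Nat.eqb i k then 1 else Rabs (x k - x i)) j).
{ intros j Hj. apply prodR_pos. intros i Hi. destruct (Nat.eqb_spec i k) as [E|E]; [lra |].
  apply Rabs_pos_lt. specialize (Hd i ltac:(lia) E). lra. }
assert (Id : forall j u, (j <= n)%nat ->
  Rabs (lagrange_basis x j k u) * prodR (fun i => if Nat.eqb i k then 1 else Rabs (x k - x i)) j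
  = prodR (fun i => if Nat.eqb i k then 1 else Rabs (u - x i)) j).
{ intros j u Hj. apply Rabs_lagrange_basis_mul. intros i Hi. apply Hd. lia. }
split; [|split; [|split]].
- intros j Hj. replace (x (k + 1 + j)%nat - x k + x k) with (x (k + 1 + j)%nat) by ring.
  split; [apply HxK; lia | apply Hs; lia].
- intros u Ku.
  apply Rmult_le_reg_r with (1 := W (k + 1 + 0)%nat ltac:(lia)).
  rewrite Id by lia. rewrite Rmult_1_l.
  replace (k + 1 + 0)%nat with (S k) by lia. simpl. rewrite Nat.eqb_refl, !Rmult_1_r.
  assert (Ex : forall v, prodR (fun i => if Nat.eqb i k then 1 else Rabs (v - x i)) k
    = prodR (fun i => Rabs (v - x i)) k).
  { intros v. apply prodR_ext. intros i Hi. destruct (Nat.eqb_spec i k); [lia | reflexivity]. }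
  rewrite !Ex. destruct k as [|k']; [simpl; lra |].
  apply Hx; [lia | exact Ku].
- intros j u Hj. replace (k + 1 + S j)%nat with (S (k + 1 + j)) by lia.
  unfold lagrange_basis at 1. simpl prodR. fold (lagrange_basis x (k + 1 + j) k (u + x k)).
  destruct (Nat.eqb_spec (k + 1 + j) k) as [E|E]; [lia |].
  rewrite Rabs_mult. f_equal. f_equal. specialize (Hd (k + 1 + j)%nat ltac:(lia) E). field. lra.
- intros j u Hj Ku.
  apply Rmult_le_reg_r with (1 := W (k + 1 + j)%nat ltac:(lia)).
  rewrite !Rmult_assoc, !Id by lia.
  replace (x (k + 1 + j)%nat - x k + x k) with (x (k + 1 + j)%nat) by ring.
  (* The factor |v - x_k| fills the gap left by the omitted index k. *)
  assert (P : forall v, Rabs (v - x k) *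
    prodR (fun i => if Nat.eqb i k then 1 else Rabs (v - x i)) (k + 1 + j)
    = prodR (fun i => Rabs (v - x i)) (k + 1 + j)).
  { intros v. rewrite Rmult_comm.
    rewrite (prodR_update (fun i => Rabs (v - x i)) 1 k (k + 1 + j)) by lia. ring. }
  replace (Rabs u) with (Rabs (u + x k - x k)) by (f_equal; ring).
  rewrite !P. apply Hx; [lia | exact Ku].
Qed.

Lemma lagrange_basis_bound K g n x r delta k t :
  (forall t, K t -> Rabs t <= r) -> green_function K g -> 0 < delta -> is_leja K n x ->
  (k < n)%nat -> K t ->
  Rabs (lagrange_basis x n k t)
    <= 2 * Rpower (diam K / delta * exp (INR n * Gmax K g delta)) (9 / 8).
Proof.
intros Hr Hg Hd Hleja Hk Kt.
set (E := exp (INR n * Gmax K g delta)).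
assert (HE : 0 < E) by apply exp_pos.
assert (HdD : delta <= diam K * E)
  by (apply delta_le_diam_mul_exp with r t; try assumption; lia).
set (s := delta / E).
assert (Hs : 0 < s <= diam K).
{ split; [apply Rdiv_lt_0_compat; assumption | apply Rle_div_l; assumption]. }
assert (EA : diam K / delta * E = diam K / s) by (unfold s; field; lra).
rewrite EA.
assert (Hexp : 2 * Rpower (diam K / s) (9 / 8) = exp (ln 2 + 9 / 8 * ln (diam K / s))).
{ rewrite exp_plus, exp_ln by lra. reflexivity. }
rewrite Hexp.
assert (HL0 : 0 <= ln (diam K / s))
  by (rewrite <- ln_1; apply ln_le; [lra | apply Rle_div_r; lra]).
(* If L_k(t) is nonzero, every other node differs from both t and x_k. *)
destruct (Req_dec (lagrange_basis x n k t) 0) as [Z|NZ].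
{ rewrite Z, Rabs_R0. left. apply exp_pos. }
assert (Hne : forall i, (i < n)%nat -> i <> k -> x k <> x i)
  by (intros i Hi Hik; apply (lagrange_basis_neq_0 x n k t i NZ Hi Hik)).
destruct (Req_dec t (x k)) as [->|Htk].
{ rewrite lagrange_basis_node, Rabs_R1, <- exp_0 by exact Hne. apply exp_le_compat.
  assert (0 < ln 2) by (rewrite <- ln_1; apply ln_increasing; lra). lra. }
assert (Hsep : forall j, (k < j < n)%nat -> s <= Rabs (x j - x k)).
{ intros j Hj. apply leja_separation with r; try assumption.
  (* As t is not a node, the product is positive at t, hence also at its maximum point x_j. *)
  apply Rlt_le_trans with (prodR (fun i => Rabs (t - x i)) j).
  - apply prodR_pos. intros i Hi. apply Rabs_pos_lt. apply Rminus_eq_contra.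
    destruct (Nat.eq_dec i k) as [->|Hik]; [exact Htk |].
    apply (lagrange_basis_neq_0 x n k t i NZ); [lia | exact Hik].
  - apply Hleja; [lia | exact Kt]. }
pose proof (leja_recursion_lagrange K n x k s Hleja Hk Hsep Hne) as Hrec.
assert (HD : forall u v, K (u + x k) -> K (v + x k) -> Rabs (u - v) <= diam K).
{ intros u v Ku Kv. replace (u - v) with ((u + x k) - (v + x k)) by ring.
  apply le_diam with r; assumption. }
pose proof (leja_recursion_ln_bound _ _ _ _ s (diam K) (t - x k) Hs Hrec HD) as H.
cbv beta in H. replace (t - x k + x k) with t in H by ring.
replace (k + 1 + (n - k - 1))%nat with n in H by lia.
assert (P : 0 < Rabs (lagrange_basis x n k t)) by (apply Rabs_pos_lt, NZ).
rewrite <- (exp_ln _ P). apply exp_le_compat, H; [lra | exact Kt | exact P].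
Qed.

(** * From the basis functions to the Lebesgue constant *)

Lemma Cmod_sumC_le (f : nat -> C) (n : nat) (B : R) :
  (forall i, (i < n)%nat -> Cmod (f i) <= B) -> Cmod (sumC f n) <= INR n * B.
Proof.
induction n as [|n IH]; intros H.
- simpl. rewrite Cmod_0. lra.
- rewrite S_INR. simpl sumC. apply Rle_trans with (1 := Cmod_triangle _ _).
  specialize (IH ltac:(auto with arith)). specialize (H n ltac:(auto with arith)). lra.
Qed.

Theorem theorem1 (K : R -> Prop) (g : C -> R) (n : nat) (x : nat -> R) (delta : R) :
  compact K -> green_function K g -> (1 <= n)%nat -> is_leja K n x -> 0 < delta ->
  Rbar_le (lebesgue_constant K x n)
    (Finite (2 * INR n *
       Rpower (diam K / delta * exp (INR n * Gmax K g delta)) (9 / 8))).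
Proof.
intros HK Hg Hn Hleja Hd.
destruct (compact_P1 K HK) as (a & b & Hab).
assert (Hr : forall t, K t -> Rabs t <= Rmax (Rabs a) (Rabs b)).
{ intros t Kt. specialize (Hab t Kt). apply RmaxAbs; apply Hab. }
apply Lub_Rbar_correct. intros r (f & _ & Hf & t & Kt & ->).
simpl Rbar_le.
set (B := Rpower _ _).
replace (2 * INR n * B) with (INR n * (2 * B)) by ring.
apply Cmod_sumC_le. intros k Hk.
rewrite Cmod_mult, Cmod_R.
pose proof (lagrange_basis_bound K g n x _ delta k t Hr Hg Hd Hleja Hk Kt) as HL.
fold B in HL.
assert (Kk : K (x k)) by (apply Hleja, Hk).
specialize (Hf (x k) Kk). pose proof (Cmod_ge_0 (f (x k))).
pose proof (Rabs_pos (lagrange_basis x n k t)). nra.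
Qed.
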